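(* Let $r\ge2$ be an integer and let $\theta\in[0,1/r]$. Then $f(r,\theta)=h(r-1,\theta)$.
   Context: Preference orders: for a total order $<$ on $[m]$ and $k\in[m]$, ${\rm rpos}_<(k)=\frac1m|\{j\in[m]:j\le k\text{ in }<\}|$. An $(r,m)$-preference order is $P=(<_1,\dots,<_r)$, total orders on $[m]$; $x\in P$ means $x=({\rm rpos}_{<_1}(k),\dots,{\rm rpos}_{<_r}(k))$ for some $k\in[m]$. For $x\in[0,1]^r$, $i_x=\min\{i:x_i=\max_jx_j\}$. For $0\le\theta\le1/r$: $f_P(\theta)=\max\{\prod_{i\ne i_x}x_i:x\in P,\ x\in[\theta,1]^r\}$, $f(r,\theta,m)=\min_Pf_P(\theta)$ over $(r,m)$-preference orders, $f(r,\theta)=\inf_{m\in\mathbb N}f(r,\theta,m)$. Covers: for $s\ge1$, an $s$-cover is an $s$-uniform hypergraph $Q$ with $V(Q)\subset[0,1]$ whose edges form a perfect matching of $V(Q)$; $h(Q)=\max_{e\in E(Q)}\prod_{y\in e}y$. For $\theta\in[0,1/(s+1))$ and $n\in\mathbb N$, an $(s,\theta,n)$-cover is an $s$-cover with $V(Q)=\{\theta+(\frac1{s+1}-\theta)\frac jn: j\in[sn]\}$. $h(s,\theta,n)=\min\{h(Q):Q\text{ an }(s,\theta,n)\text{-cover}\}$, $h(s,\theta)=\inf_nh(s,\theta,n)$, and $h(s,1/(s+1))=\lim_{\theta\to(1/(s+1))^-}h(s,\theta)=(s+1)^{-s}$. *)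

(* Defs.v *)
From mathcomp Require Import all_boot all_order all_algebra.
From mathcomp Require Import finmap.
From mathcomp Require Import all_classical all_reals all_analysis.
Set Implicit Arguments.
Unset Strict Implicit.
Unset Printing Implicit Defensive.
Import Order.TTheory GRing.Theory Num.Theory.
Import numFieldNormedType.Exports.
Local Open Scope classical_set_scope.
Local Open Scope ring_scope.

Definition total_order (T : Type) (le : rel T) : Prop :=
  [/\ reflexive le, antisymmetric le, transitive le & total le].

(* [m] is represented by 'I_m = {0, ..., m-1}; only the orders matter. *)
Definition preference_order (r m : nat) : set ('I_r -> rel 'I_m) :=
  [set P | forall i, total_order (P i)].

Definition rpos (R : realType) (m : nat) (le : rel 'I_m) (k : 'I_m) : R :=
  #|[set j : 'I_m | le j k]%SET|%:R / m%:R.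

Definition pref_point (R : realType) (r m : nat) (P : 'I_r -> rel 'I_m)
  (k : 'I_m) (i : 'I_r) : R := rpos R (P i) k.

Definition is_max_coord (R : realType) (r : nat) (x : 'I_r -> R) (i : 'I_r) :
  bool := [forall j, x j <= x i].

(* i_x, the least index of a maximal coordinate; it is None only for r = 0. *)
Definition max_index (R : realType) (r : nat) (x : 'I_r -> R) : option 'I_r :=
  [pick i | is_max_coord x i
          & [forall j : 'I_r, is_max_coord x j ==> (i <= j)%N]].

(* The default value 0 of the maximum is harmless: the products are
   nonnegative, and for m > 0 and theta <= 1/r the range is nonempty, since
   fewer than theta * m of the k : 'I_m have rpos < theta in a given order. *)
Definition f_pref (R : realType) (r m : nat) (P : 'I_r -> rel 'I_m)
    (theta : R) : R :=
  \big[Num.max/0]_(k : 'I_m |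
      [forall i, theta <= pref_point R P k i <= 1])
    \prod_(i < r | Some i != max_index (pref_point R P k)) pref_point R P k i.

(* There are finitely many preference orders for given r and m, and at least
   one, so this infimum is a minimum. *)
Definition f_size (R : realType) (r : nat) (theta : R) (m : nat) : R :=
  inf [set f_pref P theta | P in @preference_order r m].

Definition f_inf (R : realType) (r : nat) (theta : R) : R :=
  inf [set f_size r theta m | m in [set m : nat | (0 < m)%N]].

Record hypergraph (R : realType) := Hypergraph {
  vertices : {fset R};
  edges : {fset {fset R}}
}.

Definition uniform (R : realType) (s : nat) (Q : hypergraph R) : Prop :=
  forall e, e \in edges Q -> (e `<=` vertices Q)%fset /\ #|` e|%fset = s.

Definition edges_perfect_matching (R : realType) (Q : hypergraph R) : Prop :=
  trivIfset (edges Q) /\ fcover (edges Q) = vertices Q.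

Definition cover (R : realType) (s : nat) (Q : hypergraph R) : Prop :=
  [/\ (forall y, y \in vertices Q -> 0 <= y <= 1),
      uniform s Q & edges_perfect_matching Q].

Definition cover_vertices (R : realType) (s : nat) (theta : R) (n : nat) :
    {fset R} :=
  [fset (theta + (s.+1%:R^-1 - theta) * (j%:R / n%:R))%R
    | j in iota 1 (s * n)]%fset.

Definition theta_cover (R : realType) (s : nat) (theta : R) (n : nat) :
    set (hypergraph R) :=
  [set Q | cover s Q /\ vertices Q = cover_vertices s theta n].

(* Vertices of covers are nonnegative, so the default value 0 is harmless. *)
Definition h_cover (R : realType) (Q : hypergraph R) : R :=
  \big[Num.max/0]_(e <- edges Q) \prod_(y <- e) y.

(* For s, n > 0 and 0 <= theta < 1/(s+1) there are finitely many such covers,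
   and at least one, so this infimum is a minimum. *)
Definition h_size (R : realType) (s : nat) (theta : R) (n : nat) : R :=
  inf [set h_cover Q | Q in theta_cover s theta n].

Definition h_inf (R : realType) (s : nat) (theta : R) : R :=
  inf [set h_size s theta n | n in [set n : nat | (0 < n)%N]].

(* For theta = 1/(s+1) the vertices theta + (1/(s+1) - theta) j/n collapse, and
   h is defined there by continuity from the left. *)
Definition h_ext (R : realType) (s : nat) (theta : R) : R :=
  if theta == s.+1%:R^-1 then lim (h_inf s t @[t --> (s.+1%:R^-1 : R)^'-])
  else h_inf s theta.

(* Main.v *)
(** Both inequalities come from a dictionary between covers and orders, with
    r = s + 1 and an error that tends to 0.  Given an (s, theta, n)-cover, take
    about theta m candidates per order placed at its bottom (so that they leave
    [theta, 1]^r), and split the rest into r classes of n blocks.  In class c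
    the coordinate c is largest, and the other s coordinates of the e-th block
    are the vertices of the e-th edge, shifted cyclically with c so that every
    coordinate uses each vertex once.
    Conversely, given orders on m candidates, at least (1 - r theta) m of them
    have all coordinates >= theta; their s non-maximal coordinates form the
    edges.  Each rank is used at most r times, so the t-th smallest of these
    values is at least the t-th vertex of the cover up to 2/m; replacing every
    candidate by L copies makes this error negligible and does not increase f.
    The maximal coordinate never has to be identified: omitting another
    coordinate only increases the product.  At theta = 1 / r both sides are
    r ^ -s, by monotonicity of f in theta and t ^ s <= h(s, t). *)
Require Import Defs.
From mathcomp Require Import all_boot all_order all_algebra.
From mathcomp Require Import finmap.
From mathcomp Require Import all_classical all_reals all_analysis.
From mathcomp Require Import lra zify.
Set Implicit Arguments.
Unset Strict Implicit.
Unset Printing Implicit Defensive.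
Import Order.TTheory GRing.Theory Num.Theory.
Import numFieldNormedType.Exports.
Local Open Scope ring_scope.

(** * Products with one coordinate omitted, and their stability under shifts *)

Section Products.
Variable R : realType.

Lemma prod_skip_lift (s : nat) (j : 'I_s.+1) (F : 'I_s.+1 -> R) :
  \prod_(i < s.+1 | i != j) F i = \prod_(k < s) F (lift j k).
Proof.
rewrite big_mkcond (bigD1_ord j) //= eqxx mul1r.
by apply: eq_bigr => k _; rewrite eq_sym neq_lift.
Qed.

(** The factors outside [i0] and [j] are common to both sides; what remains is [x j] on the left and
    [x i0] on the right. *)
Lemma prod_skip_max_le (r : nat) (x : 'I_r -> R) (i0 j : 'I_r) :
  (forall i, 0 <= x i) -> x j <= x i0 ->
  \prod_(i < r | i != i0) x i <= \prod_(i < r | i != j) x i.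
Proof.
move=> x0 xj; have [->//|ij] := eqVneq i0 j.
rewrite (bigD1 j) 1?eq_sym //= [leRHS](bigD1 i0) //=.
rewrite [X in x i0 * X](eq_bigl (fun i => (i != i0) && (i != j))); last first.
  by move=> i; rewrite andbC.
by apply: ler_wpM2r => //; apply: prodr_ge0.
Qed.

(** Factors are exchanged one at a time; each exchange costs at most [d] because all the other
    factors lie in [0, 1]. *)
Lemma prod_le_shift (I : Type) (l : seq I) (x y : I -> R) (d : R) :
  0 <= d -> (forall i, 0 <= x i <= 1) -> (forall i, 0 <= y i <= 1) ->
  (forall i, y i <= x i + d) ->
  \prod_(i <- l) y i <= \prod_(i <- l) x i + (size l)%:R * d.
Proof.
move=> d0 x01 y01 yx; elim: l => [|i l IH] /=.
  by rewrite !big_nil mul0r addr0.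
rewrite !big_cons.
have /andP[xi0 xi1] := x01 i.
have Y0 : 0 <= \prod_(j <- l) y j.
  by apply: prodr_ge0 => j _; case/andP: (y01 j).
have Y1 : \prod_(j <- l) y j <= 1 by apply: prodr_ile1 => j _.
apply: (le_trans (ler_wpM2r Y0 (yx i))).
rewrite mulrDl -natr1 mulrDl mul1r addrA lerD ?ler_piMr //.
apply: (le_trans (ler_wpM2l xi0 IH)).
rewrite mulrDr lerD2l ler_piMl ?mulr_ge0 ?ler0n //.
Qed.

End Products.

(** * Ranks in a finite total order, and orders given by injective keys *)

Section Ranks.
Variables (T : finType) (le : rel T).
Hypothesis le_total : total_order le.

Definition rank_of (k : T) : nat := #|[set j : T | le j k]%SET|.

(** Lower sets are nested along [le], so two of equal cardinality coincide, and antisymmetry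
    concludes. *)
Lemma rank_of_inj : injective rank_of.
Proof.
case: le_total => refl anti tr tot.
have aux j k : le j k -> rank_of j = rank_of k -> j = k.
  move=> jk rjk; apply: anti; rewrite jk /=.
  have sub : [set i | le i j]%SET \subset [set i | le i k]%SET.
    by apply/fintype.subsetP => i; rewrite !inE => ij; exact: tr ij jk.
  have /eqP E : [set i | le i j]%SET == [set i | le i k]%SET.
    by rewrite eqEcard sub; move: rjk; rewrite /rank_of => ->; rewrite leqnn.
  have : k \in [set i | le i j]%SET by rewrite E inE refl.
  by rewrite inE.
move=> j k rjk; case/orP: (tot j k) => h; first exact: aux.
by apply/esym/aux.
Qed.

Lemma rank_of_gt0 (k : T) : (0 < rank_of k)%N.
Proof.
by case: le_total => refl _ _ _; apply/card_gt0P; exists k; rewrite inE refl.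
Qed.

Lemma rank_of_max (k : T) : (rank_of k <= #|T|)%N.
Proof. exact: max_card. Qed.

End Ranks.

Lemma card_inj_range (T : finType) (A : {pred T}) (g : T -> nat) (a b : nat) :
  {in A &, injective g} -> (forall k, k \in A -> (a <= g k < b)%N) ->
  (#|A| <= b - a)%N.
Proof.
move=> ginj gab; rewrite cardE -(size_map g) -(size_iota a (b - a)).
apply: uniq_leq_size.
  rewrite map_inj_in_uniq ?enum_uniq // => i j; rewrite !mem_enum.
  exact: ginj.
move=> _ /mapP[k + ->]; rewrite mem_enum => /gab /andP[ak kb].
by rewrite mem_iota ak subnKC // (leq_trans ak (ltnW kb)).
Qed.

Lemma key_total_order (T : finType) (g : T -> nat) :
  injective g -> total_order (fun j k => (g j <= g k)%N).
Proof.
move=> ginj; split.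
- by move=> j /=.
- by move=> j k /= /anti_leq /ginj.
- by move=> j i k /=; exact: leq_trans.
- by move=> j k; exact: leq_total.
Qed.

(** * Bounds for [f_pref] and [f_inf] *)

Section Preferences.
Variable R : realType.

Lemma pref_point_ge0 (r m : nat) (P : 'I_r -> rel 'I_m) k i :
  0 <= pref_point R P k i.
Proof. by rewrite divr_ge0 ?ler0n. Qed.

Lemma pref_point_le1 (r m : nat) (P : 'I_r -> rel 'I_m) k i :
  pref_point R P k i <= 1.
Proof.
have m0 : (0 < m)%N by case: m k {P} => // -[].
rewrite ler_pdivrMr ?ltr0n // mul1r ler_nat.
by rewrite (leq_trans (max_card _)) ?card_ord.
Qed.

Lemma max_index_exists (s : nat) (x : 'I_s.+1 -> R) :
  exists2 i, max_index x = Some i & forall j, x j <= x i.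
Proof.
rewrite /max_index; case: pickP => [i /andP[/forallP xi _]|none].
  by exists i.
pose i0 := [arg max_(i > ord0) x i]%O.
have mi0 : is_max_coord x i0.
  by apply/forallP => j; rewrite /i0; case: arg_maxP => //= i _; apply.
case: (arg_minnP (fun i : 'I_s.+1 => nat_of_ord i) mi0) => i mi imin.
have := none i; rewrite mi /= => /negP[]; apply/forallP => j.
by apply/implyP => /imin.
Qed.

Lemma f_pref_ge0 (r m : nat) (P : 'I_r -> rel 'I_m) (theta : R) :
  0 <= f_pref P theta.
Proof. by rewrite /f_pref; apply: bigmax_ge_id. Qed.

(** By [prod_skip_max_le], a bound on the product that omits any coordinate [j] also bounds the one
    that omits [max_index]. *)
Lemma f_pref_le (s m : nat) (P : 'I_s.+1 -> rel 'I_m) (theta c : R) :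
  0 <= c ->
  (forall k, (forall i, theta <= pref_point R P k i) ->
    exists j : 'I_s.+1, \prod_(i < s) pref_point R P k (lift j i) <= c) ->
  f_pref P theta <= c.
Proof.
move=> c0 H; apply: bigmax_le => // k /forallP Hk.
have [j] := H k (fun i => proj1 (andP (Hk i))).
have [i0 -> imax] := max_index_exists (pref_point R P k).
rewrite -prod_skip_lift; apply: le_trans.
rewrite (eq_bigl (fun i => i != i0)); last by move=> i.
by apply: prod_skip_max_le => // i; exact: pref_point_ge0.
Qed.

Lemma le_f_pref (s m : nat) (P : 'I_s.+1 -> rel 'I_m) (theta : R) k :
  (forall i, theta <= pref_point R P k i) ->
  exists j : 'I_s.+1, \prod_(i < s) pref_point R P k (lift j i) <= f_pref P theta.
Proof.
move=> Hk; have [i0 E imax] := max_index_exists (pref_point R P k).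
exists i0; rewrite -prod_skip_lift.
rewrite (eq_bigl (fun i => Some i != max_index (pref_point R P k))); last first.
  by move=> i; rewrite E.
apply: (@le_bigmax_cond _ R 'I_m 0 k _ (fun k =>
  \prod_(i < s.+1 | Some i != max_index (pref_point R P k))
    pref_point R P k i)).
by apply/forallP => i; rewrite Hk pref_point_le1.
Qed.

Lemma inf_le_mem (S : set R) x :
  (forall y, S y -> 0 <= y) -> S x -> inf S <= x.
Proof. by move=> S0 Sx; apply: ge_inf => //; exists 0 => y /S0. Qed.

Lemma f_size_ge0 (r m : nat) (theta : R) : 0 <= f_size r theta m.
Proof.
rewrite /f_size; set S := (X in inf X).
(* The infimum of the empty set is 0 by convention, so nonnegativity survives in that case. *)
have [->|/set0P[x Sx]] := eqVneq S set0; first by rewrite inf0.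
by apply: lb_le_inf; [exists x|move=> _ [P _ <-]; exact: f_pref_ge0].
Qed.

Lemma f_inf_le (r m : nat) (P : 'I_r -> rel 'I_m) (theta : R) :
  (0 < m)%N -> preference_order P -> f_inf r theta <= f_pref P theta.
Proof.
move=> m0 tP; apply: (@le_trans _ _ (f_size r theta m)).
  apply: inf_le_mem; last by exists m.
  by move=> _ [n _ <-]; exact: f_size_ge0.
apply: inf_le_mem; last by exists P.
by move=> _ [n _ <-]; exact: f_pref_ge0.
Qed.

Lemma le_f_inf (r : nat) (theta c : R) :
  (forall m (P : 'I_r -> rel 'I_m), (0 < m)%N -> preference_order P ->
    c <= f_pref P theta) -> c <= f_inf r theta.
Proof.
move=> H; apply: lb_le_inf; first by exists (f_size r theta 1), 1%N.
move=> _ [m m0 <-]; apply: lb_le_inf; last by move=> _ [P tP <-]; exact: H.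
pose P (_ : 'I_r) (j k : 'I_m) := (j <= k)%N.
exists (f_pref P theta), P => // i; exact/(@key_total_order _ val)/val_inj.
Qed.

Lemma f_inf_anti (r : nat) (t u : R) : t <= u -> f_inf r u <= f_inf r t.
Proof.
move=> tu; apply: le_f_inf => m P m0 tP; apply: le_trans (f_inf_le _ m0 tP) _.
apply: bigmax_le => [|k /forallP Hk]; first exact: f_pref_ge0.
rewrite {1}/f_pref.
apply: (@le_bigmax_cond _ R 'I_m 0 k _ (fun k =>
  \prod_(i < r | Some i != max_index (pref_point R P k))
    pref_point R P k i)).
apply/forallP => i; have /andP[ux ->] := Hk i.
by rewrite (le_trans tu ux).
Qed.

End Preferences.

(** * Covers as labellings of the slots of abstract edges *)

Section Labellings.
Variables (R : realType) (s : nat).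

Definition cover_vertex (theta : R) (n j : nat) : R :=
  theta + (s.+1%:R^-1 - theta) * (j%:R / n%:R).

(* [rho (e, j)] is the index (in [1, s * n]) of the [j]-th vertex of [e]. *)
Definition labelling (E : finType) (rho : E * 'I_s -> nat) : Prop :=
  injective rho /\ forall p, (0 < rho p <= s * #|E|)%N.

Lemma cover_vertex_inj (theta : R) (n : nat) :
  (0 < n)%N -> theta < s.+1%:R^-1 -> injective (cover_vertex theta n).
Proof.
move=> n0 th i j /addrI /mulfI; rewrite subr_eq0 => /(_ (negbT (gt_eqF th))).
move=> /(divIf (lt0r_neq0 _)); rewrite ltr0n => /(_ n0) /eqP.
by rewrite eqr_nat => /eqP.
Qed.

Lemma cover_vertex_ge (theta : R) (n j : nat) :
  theta <= s.+1%:R^-1 -> theta <= cover_vertex theta n j.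
Proof. by move=> th; rewrite lerDl mulr_ge0 ?subr_ge0 // divr_ge0 ?ler0n. Qed.

Lemma cover_vertex_le (theta : R) (n j : nat) :
  (0 < n)%N -> theta <= s.+1%:R^-1 -> (j <= s * n)%N ->
  cover_vertex theta n j <= theta + (s.+1%:R^-1 - theta) * s%:R.
Proof.
move=> n0 th jn; rewrite lerD2l ler_wpM2l ?subr_ge0 //.
by rewrite ler_pdivrMr ?ltr0n // -natrM ler_nat.
Qed.

Lemma cover_vertex_le1 (theta : R) (n j : nat) :
  (0 < s)%N -> (0 < n)%N -> 0 <= theta <= s.+1%:R^-1 -> (j <= s * n)%N ->
  cover_vertex theta n j <= 1.
Proof.
move=> s0 n0 /andP[th0 th] jn; apply: le_trans (cover_vertex_le n0 th jn) _.
have S : s.+1%:R^-1 * s.+1%:R = 1 :> R by rewrite mulVf ?pnatr_eq0.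
have : theta * 1 <= theta * s%:R by rewrite ler_wpM2l // ler1n.
have : 0 <= s.+1%:R^-1 :> R by rewrite invr_ge0 ler0n.
(* With S = s + 1, the bound equals s / S - (s - 1) theta. *)
move: S; rewrite -natr1 mulrDr mulr1 mulrBl; lra.
Qed.

Lemma cover_verticesP (theta : R) (n : nat) (x : R) :
  reflect (exists2 i, i \in iota 1 (s * n) & x = cover_vertex theta n i)
    (x \in cover_vertices s theta n).
Proof. by rewrite /cover_vertices; apply: (iffP (imfsetP _ _ _ _)). Qed.

Lemma labelling_image (E : finType) (rho : E * 'I_s -> nat) :
  labelling rho -> [seq rho p | p : E * 'I_s] =i iota 1 (s * #|E|).
Proof.
move=> [rinj rr]; apply: (uniq_min_size _ _ _).2.
- by rewrite map_inj_uniq // enum_uniq.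
- by move=> _ /mapP[p _ ->]; rewrite mem_iota add1n ltnS; exact: rr.
- by rewrite size_iota size_map -cardT card_prod card_ord mulnC.
Qed.

Lemma labelling_exists (n : nat) :
  exists rho : 'I_n * 'I_s -> nat, labelling rho.
Proof.
exists (fun p => (enum_rank p).+1); split.
  by move=> p q [] /val_inj /enum_rank_inj.
by move=> p; rewrite /= (leq_trans (ltn_ord _)) // card_prod !card_ord mulnC.
Qed.

(** The edge of [e] collects the vertices labelled by its slots. As theta < 1/(s+1), distinct labels
    give distinct vertices, so edges have s elements and are disjoint; they cover because an
    injective labelling is onto [1, s n]. *)
Lemma labelling_cover (E : finType) (rho : E * 'I_s -> nat) (theta c : R) :
  (0 < s)%N -> (0 < #|E|)%N -> 0 <= theta < s.+1%:R^-1 -> labelling rho ->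
  0 <= c -> (forall e, \prod_j cover_vertex theta #|E| (rho (e, j)) <= c) ->
  exists2 Q, theta_cover s theta #|E| Q & h_cover Q <= c.
Proof.
move=> s0 n0 /andP[th0 th] lab c0 Hc; have [rinj rr] := lab.
pose n := #|E|; pose v e j := cover_vertex theta n (rho (e, j)).
have vinj e : injective (v e).
  by move=> i j /(cover_vertex_inj n0 th) /rinj [].
pose es e := [seq v e j | j <- enum 'I_s].
have ues e : uniq (es e) by rewrite map_inj_uniq // enum_uniq.
pose ed e : {fset R} := seq_fset tt (es e).
have mem_ed e x : reflect (exists j, x = v e j) (x \in ed e).
  rewrite seq_fsetE; apply: (iffP mapP) => [[j _ ->]|[j ->]]; first by exists j.
  by exists j; rewrite ?mem_enum.
pose Es : {fset {fset R}} := seq_fset tt [seq ed e | e <- enum E].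
have mem_Es A : reflect (exists e, A = ed e) (A \in Es).
  rewrite seq_fsetE; apply: (iffP mapP) => [[e _ ->]|[e ->]]; first by exists e.
  by exists e; rewrite ?mem_enum.
have mem_V x : reflect (exists p, x = v p.1 p.2)
    (x \in cover_vertices s theta n).
  apply: (iffP (cover_verticesP _ _ _)) => [[i + ->]|[[e j] ->]].
    rewrite -(labelling_image lab) => /mapP[[e j] _ ->].
    by exists (e, j).
  exists (rho (e, j)) => //=.
  by rewrite mem_iota add1n ltnS; exact: rr.
exists (Hypergraph (cover_vertices s theta n) Es); last first.
  rewrite /h_cover big_seq; apply: bigmax_le => // A /mem_Es[e ->].
  rewrite (perm_big (es e)); last first.
    by rewrite (perm_trans (seq_fset_perm _ _)) // undup_id.
  by rewrite big_map big_enum; exact: Hc.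
split=> //; split.
- move=> y /mem_V[[e j] ->] /=.
  have /andP[_ rs] := rr (e, j).
  by rewrite (le_trans th0) ?cover_vertex_ge ?cover_vertex_le1 ?th0 ?ltW.
- move=> A /mem_Es[e ->]; split.
    by apply/fsubsetP => x /mem_ed[j ->]; apply/mem_V; exists (e, j).
  by rewrite size_seq_fset undup_id // size_map size_enum_ord.
- split.
    apply/trivIfsetP => _ _ /mem_Es[e1 ->] /mem_Es[e2 ->] e12.
    apply/fdisjointP => x /mem_ed[j1 ->]; apply/negP => /mem_ed[j2].
    by move=> /(cover_vertex_inj n0 th) /rinj [ee _]; rewrite ee eqxx in e12.
  apply/fsetP => x; apply/bigfcupP/mem_V => [[A /andP[/mem_Es[e ->] _]]|].
    by move=> /mem_ed[j ->]; exists (e, j).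
  move=> [[e j] ->]; exists (ed e); last by apply/mem_ed; exists j.
  by rewrite andbT; apply/mem_Es; exists e.
Qed.

Lemma cover_labelling (theta : R) (n : nat) (Q : hypergraph R) :
  (0 < s)%N -> (0 < n)%N -> theta < s.+1%:R^-1 ->
  theta_cover s theta n Q ->
  exists (E : finType) (rho : E * 'I_s -> nat),
    [/\ #|E| = n, labelling rho &
      forall e, \prod_j cover_vertex theta n (rho (e, j)) <= h_cover Q].
Proof.
move=> s0 n0 th [[_ unif [triv cov]] VQ].
have vinj := cover_vertex_inj n0 th.
have cardV : #|` vertices Q|%fset = (s * n)%N.
  rewrite VQ -(size_iota 1 (s * n)) -(size_map (cover_vertex theta n)).
  apply/perm_size/uniq_perm; first exact: fset_uniq.
    by rewrite map_inj_uniq // iota_uniq.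
  move=> x; apply/cover_verticesP/mapP => -[i il ->]; by exists i.
(* Double counting: s times the number of edges is the number s n of vertices. *)
have cardE : #|{: edges Q}| = n.
  apply/eqP; rewrite -(eqn_pmul2l s0) -cardV -cov.
  have [_] := leq_card_fcover (edges Q); rewrite triv => /eqP ->.
  rewrite big_seq (eq_bigr (fun=> s)) => [|A /unif[_] //].
  by rewrite -big_seq big_const_seq count_predT iter_addn_0 -cardfE.
pose l := [seq cover_vertex theta n i | i <- iota 1 (s * n)].
pose y (p : edges Q * 'I_s) : R := nth 0 (fsval p.1) p.2.
have size_edge (e : edges Q) : size (enum_fset (fsval e)) = s.
  by have [_] := unif _ (fsvalP e).
have y_in p : y p \in fsval p.1.
  by rewrite /y; apply: mem_nth; rewrite size_edge.
have y_l p : y p \in l.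
  have : y p \in vertices Q.
    by have [/fsubsetP sub _] := unif _ (fsvalP p.1); exact: sub (y_in p).
  by rewrite VQ => /cover_verticesP[i il ->]; apply: map_f.
(* Positions in [l] start at 0, labels at 1. *)
pose rho p := (index (y p) l).+1.
have y_rho p : y p = cover_vertex theta n (rho p).
  have lt : (index (y p) l < s * n)%N.
    by move: (y_l p); rewrite -index_mem size_map size_iota.
  rewrite -[LHS](nth_index 0 (y_l p)) (nth_map 0%N) ?size_iota //.
  by rewrite nth_iota // add1n.
exists {: edges Q}, rho; split=> //.
  split.
    move=> [e1 j1] [e2 j2] rr.
    have yy : y (e1, j1) = y (e2, j2) by rewrite !y_rho rr.
    have e12 : e1 = e2.
      apply/val_inj/eqP/negPn/negP => /= ne.
      have /fdisjointP := trivIfsetP _ triv _ _ (fsvalP e1) (fsvalP e2) ne.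
      by move=> /(_ _ (y_in (e1, j1))); rewrite yy (y_in (e2, j2)).
    rewrite -e12 in yy *; congr (_, _); apply/val_inj/eqP.
    rewrite -(nth_uniq 0 _ _ (fset_uniq (fsval e1))) ?size_edge; [|exact: ltn_ord..].
    by apply/eqP; exact: yy.
  move=> p; rewrite /rho /= cardE.
  by move: (y_l p); rewrite -index_mem size_map size_iota.
move=> e; rewrite -(eq_bigr _ (fun j _ => y_rho (e, j))) /y /=.
apply: (@le_trans _ _ (\prod_(x <- fsval e) x)).
  by rewrite [leRHS](big_nth 0) size_edge big_mkord.
by apply: (@le_bigmax_seq _ R _ (edges Q) 0 (fsval e) predT
  (fun e => \prod_(x <- e) x)); rewrite ?fsvalP.
Qed.

Lemma h_cover_ge0 (Q : hypergraph R) : 0 <= h_cover Q.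
Proof. by rewrite /h_cover; apply: bigmax_ge_id. Qed.

Lemma h_inf_le (E : finType) (rho : E * 'I_s -> nat) (theta c : R) :
  (0 < s)%N -> (0 < #|E|)%N -> 0 <= theta < s.+1%:R^-1 -> labelling rho ->
  0 <= c -> (forall e, \prod_j cover_vertex theta #|E| (rho (e, j)) <= c) ->
  h_inf s theta <= c.
Proof.
move=> s0 n0 th lab c0 Hc.
have [Q tQ] := labelling_cover s0 n0 th lab c0 Hc; apply: le_trans.
apply: (@le_trans _ _ (h_size s theta #|E|)).
  apply: inf_le_mem; last by exists #|E|.
  move=> _ [n _ <-]; rewrite /h_size; set S := (X in inf X).
  have [->|/set0P[x Sx]] := eqVneq S set0; first by rewrite inf0.
  by apply: lb_le_inf; [exists x|move=> _ [Q' _ <-]; exact: h_cover_ge0].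
apply: inf_le_mem; last by exists Q.
by move=> _ [Q' _ <-]; exact: h_cover_ge0.
Qed.

Lemma le_h_inf (theta c : R) :
  (0 < s)%N -> 0 <= theta < s.+1%:R^-1 ->
  (forall (E : finType) (rho : E * 'I_s -> nat) b, (0 < #|E|)%N ->
    labelling rho ->
    (forall e, \prod_j cover_vertex theta #|E| (rho (e, j)) <= b) -> c <= b) ->
  c <= h_inf s theta.
Proof.
move=> s0 th H; have /andP[th0 th1] := th.
apply: lb_le_inf; first by exists (h_size s theta 1), 1%N.
move=> _ [n n0 <-]; apply: lb_le_inf; last first.
  move=> _ [Q tQ <-].
  have [E [rho [cE lab hE]]] := cover_labelling s0 n0 th1 tQ.
  by apply: (H E rho); rewrite ?cE.
(* It remains to see that covers exist; the bound 1 on the products is only a placeholder. *)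
have [rho lab] := labelling_exists n.
have [|||Q tQ _] := @labelling_cover _ rho theta 1 s0 _ th lab.
- by rewrite card_ord.
- by [].
- move=> e; apply: prodr_ile1 => j _.
  have [_ /(_ (e, j)) /andP[_ rs]] := lab.
  rewrite (le_trans th0) ?cover_vertex_ge ?cover_vertex_le1 ?card_ord ?th0 ?ltW//.
  by rewrite card_ord in rs.
- by exists (h_cover Q), Q; rewrite ?card_ord // in tQ *.
Qed.

End Labellings.

(** * From covers to preference orders *)

Lemma prod_le_shift_ord (R : realType) (s : nat) (x y : 'I_s -> R) (d : R) :
  0 <= d -> (forall i, 0 <= x i <= 1) -> (forall i, 0 <= y i <= 1) ->
  (forall i, y i <= x i + d) ->
  \prod_i y i <= \prod_i x i + s%:R * d.
Proof.
move=> d0 x01 y01 yx; rewrite -big_enum -[\prod_i x i]big_enum /=.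
by have := prod_le_shift (enum 'I_s) d0 x01 y01 yx; rewrite size_enum_ord.
Qed.

(** Elements not above [k] have distinct keys in [0, g k]. Keys may leave gaps, hence an
    inequality. *)
Lemma rpos_key_le (R : realType) (m : nat) (g : 'I_m -> nat) k :
  injective g -> rpos R (fun i j => (g i <= g j)%N) k <= (g k).+1%:R / m%:R.
Proof.
move=> ginj; rewrite ler_wpM2r ?invr_ge0 ?ler0n // ler_nat.
rewrite -[leqRHS]subn0; apply: (@card_inj_range _ _ g).
  by move=> i j _ _; exact: ginj.
by move=> i; rewrite inE ltnS.
Qed.

Lemma divmod_inj (b q1 q2 l1 l2 : nat) :
  (l1 < b)%N -> (l2 < b)%N -> (q1 * b + l1 = q2 * b + l2)%N ->
  q1 = q2 /\ l1 = l2.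
Proof.
move=> h1 h2 e; have b0 : (0 < b)%N by apply: leq_ltn_trans h1.
split.
  by have := congr1 (divn^~ b) e; rewrite !divnMDl // !divn_small // !addn0.
by have := congr1 (modn^~ b) e; rewrite !modnMDl !modn_small.
Qed.

Lemma block_lt (b q l n : nat) :
  (q < n)%N -> (l < b)%N -> (q * b + l < n * b)%N.
Proof.
move=> qn lb; apply: (@leq_trans (q.+1 * b)).
  by rewrite mulSn addnC ltn_add2r.
by rewrite leq_mul2r qn orbT.
Qed.

Lemma add_lt_neq (a x N y : nat) : (x < N)%N -> (a + x)%N <> (a + N + y)%N.
Proof. by move=> xN; rewrite -addnA => /addnI; lia. Qed.

Section FromCover.
Variables (R : realType) (s : nat) (E : finType) (rho : E * 'I_s -> nat).
Hypothesis lab : labelling rho.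
Variables (n M A : nat).
Hypothesis card_edges : #|E| = n.

Local Notation B := (M - A)%N.

(* [inl (c, e, l)]: the [l]-th copy of the edge [e] in the class of candidates
   whose largest coordinate is [c]; [inr (c, u)]: the candidate of rank [u],
   below the threshold, in the order [c]. *)
Definition candidate : finType :=
  (('I_s.+1 * E * 'I_B) + ('I_s.+1 * 'I_(n * A)))%type.

(* In the class [c] the coordinate [c + 1 + j] modulo [s + 1] carries the [j]-th
   vertex of the edge, so that each coordinate meets every vertex once when [c]
   varies. *)
Definition candidate_key (i : 'I_s.+1) (t : candidate) : nat :=
  match t with
  | inl (c, e, l) =>
    if unlift ord0 (i - c) is Some j
    then (n * A + ((rho (e, j)).-1 * B + l))%N
    else (n * A + s * n * B + (enum_rank e * B + l))%N
  | inr (c, u) =>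
    if c == i then nat_of_ord u
    else (n * A + s * n * B + n * B + enum_rank (c, u))%N
  end.

Lemma labelling_range p : (0 < rho p <= s * n)%N.
Proof. by rewrite -card_edges; exact: lab.2. Qed.

(** Keys for [i] lie in four consecutive ranges: low candidates of [i], blocks indexed by vertex
    labels, the class [i] itself, and low candidates of the other orders. Within a range the key
    determines the candidate. *)
Lemma candidate_key_inj i : injective (candidate_key i).
Proof.
have [rinj _] := lab; have rr := labelling_range.
have rlt e j : ((rho (e, j)).-1 < s * n)%N.
  by have /andP[] := rr (e, j); case: (rho (e, j)).
have elt (e : E) : (enum_rank e < n)%N by rewrite -card_edges ltn_ord.
have unl c j : unlift ord0 (i - c) = Some j -> c = i - lift ord0 j.
  by case: unliftP => // k ik [<-]; rewrite -ik opprB addrC subrK.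
have unl0 c : unlift ord0 (i - c) = None -> c = i.
  by case: unliftP => // /eqP; rewrite subr_eq0 => /eqP.
move=> [[[c1 e1] l1]|[c1 u1]] [[[c2 e2] l2]|[c2 u2]] /=.
- case E1 : (unlift _ _) => [j1|]; case E2 : (unlift _ _) => [j2|].
  + move=> /addnI /(divmod_inj (ltn_ord _) (ltn_ord _))[re /val_inj ->].
    have /rinj[-> jj] : rho (e1, j1) = rho (e2, j2).
      have /andP[r1 _] := rr (e1, j1); have /andP[r2 _] := rr (e2, j2).
      by rewrite -(prednK r1) -(prednK r2) re.
    by rewrite (unl _ _ E1) (unl _ _ E2) jj.
  + by have := block_lt (rlt e1 j1) (ltn_ord l1); lia.
  + by have := block_lt (rlt e2 j2) (ltn_ord l2); lia.
  + move=> /addnI /(divmod_inj (ltn_ord _) (ltn_ord _))[re /val_inj ->].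
    by rewrite (enum_rank_inj (val_inj re)) (unl0 _ E1) (unl0 _ E2).
- case E1 : (unlift _ _) => [j1|]; case: eqP => _.
  + by move=> h; have := ltn_ord u2; rewrite -h -?addnA ltnNge leq_addr.
  + by have := block_lt (rlt e1 j1) (ltn_ord l1); lia.
  + by move=> h; have := ltn_ord u2; rewrite -h -?addnA ltnNge leq_addr.
  + by move=> /(add_lt_neq (block_lt (elt e1) (ltn_ord l1))).
- case E1 : (unlift _ _) => [j1|]; case: eqP => _.
  + by move=> h; have := ltn_ord u1; rewrite h -?addnA ltnNge leq_addr.
  + by have := block_lt (rlt e2 j1) (ltn_ord l2); lia.
  + by move=> h; have := ltn_ord u1; rewrite h -?addnA ltnNge leq_addr.
  + by move=> /esym /(add_lt_neq (block_lt (elt e2) (ltn_ord l2))).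
- case: eqP => [->|_]; case: eqP => [->|_].
  + by move=> /val_inj ->.
  + by move=> h; have := ltn_ord u1; rewrite h -?addnA ltnNge leq_addr.
  + by move=> h; have := ltn_ord u2; rewrite -h -?addnA ltnNge leq_addr.
  + by move=> /addnI /val_inj /enum_rank_inj ->.
Qed.

Lemma card_candidate : (A <= M)%N -> #|candidate| = (s.+1 * n * M)%N.
Proof.
move=> AM; rewrite card_sum !card_prod !card_ord card_edges.
by rewrite -mulnA -mulnDr -mulnA (mulnC n A) (mulnC n) -mulnDl subnK // (mulnC M).
Qed.

Definition cover_pref (i : 'I_s.+1) (j k : 'I_#|candidate|) : bool :=
  (candidate_key i (enum_val j) <= candidate_key i (enum_val k))%N.

(** Put x = A / ((s+1) M), the fraction of low candidates per order. A coordinate with label j is at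
    most x + (1/(s+1) - x) q with q = j / n <= s. Replacing x by theta costs at most (theta - x) q
    <= s d per coordinate, hence s (s d) for the product. *)
Lemma f_inf_le_labelling (theta c d : R) :
  (0 < s)%N -> (0 < n)%N -> (0 < M)%N -> (A <= M)%N ->
  0 <= theta < s.+1%:R^-1 ->
  (A == 0)%N || (A%:R / (s.+1 * M)%:R < theta) ->
  0 <= d -> theta <= A%:R / (s.+1 * M)%:R + d ->
  0 <= c -> (forall e, \prod_j cover_vertex s theta n (rho (e, j)) <= c) ->
  f_inf s.+1 theta <= c + s%:R * (s%:R * d).
Proof.
move=> s0 n0 M0 AM /andP[th0 th1] Ath d0 thd c0 Hc.
have m0 : (0 < #|candidate|)%N by rewrite card_candidate // !muln_gt0 n0.
have pinj i : injective (fun j : 'I_#|candidate| => candidate_key i (enum_val j)).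
  by move=> j k /candidate_key_inj /enum_val_inj.
apply: (le_trans (@f_inf_le _ _ _ cover_pref _ m0 _)).
  by move=> i; exact: key_total_order (pinj i).
have card_real : #|candidate|%:R = s.+1%:R * n%:R * M%:R :> R.
  by rewrite card_candidate // !natrM.
have nR : 0 < n%:R :> R by rewrite ltr0n.
have MR : 0 < M%:R :> R by rewrite ltr0n.
have sR : 0 < s.+1%:R :> R by rewrite ltr0n.
have tA : n%:R * A%:R / #|candidate|%:R = A%:R / (s.+1 * M)%:R :> R.
  rewrite card_real natrM (mulrC s.+1%:R) -(mulrA n%:R s.+1%:R).
  by rewrite -mulf_div divff ?mul1r ?gt_eqF.
have rle k i : pref_point R cover_pref k i <=
    (candidate_key i (enum_val k)).+1%:R / #|candidate|%:R.
  exact: (@rpos_key_le R _ (fun j => candidate_key i (enum_val j))).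
apply: f_pref_le => [|k Hk]; first by rewrite addr_ge0 ?mulr_ge0 ?ler0n.
(* A low candidate of the order [cl] has there a coordinate at most A / ((s+1) M) < theta, against
   [Hk]. *)
case Ek : (enum_val k) => [[[cl e] l]|[cl u]]; last first.
  have A0 : (0 < A)%N.
    by have := leq_ltn_trans (leq0n u) (ltn_ord u); rewrite muln_gt0 => /andP[].
  move: Ath; rewrite gtn_eqF //= => Ath.
  have := le_trans (Hk cl) (rle k cl); rewrite Ek /= eqxx => h.
  have : u.+1%:R / #|candidate|%:R <= A%:R / (s.+1 * M)%:R :> R.
    by rewrite -tA ler_wpM2r ?invr_ge0 ?ler0n // -natrM ler_nat ltn_ord.
  by move=> /(le_trans h) /le_lt_trans /(_ Ath); rewrite ltxx.
exists cl; rewrite -prod_skip_lift.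
(* The cyclic shift by [cl] turns the omitted coordinate into [ord0], and [lift ord0 j] then carries
   the [j]-th vertex. *)
rewrite (reindex_inj (addIr cl)) /=.
rewrite (eq_bigl (fun i => i != ord0)); last first.
  by move=> i; rewrite -subr_eq0 addrK.
rewrite prod_skip_lift.
have rr := labelling_range.
apply: (@le_trans _ _ (\prod_j cover_vertex s theta n (rho (e, j)) +
                       s%:R * (s%:R * d))); last by rewrite lerD2r.
have thM : A%:R / (s.+1 * M)%:R <= theta.
  by case/orP: Ath => [/eqP ->|/ltW //]; rewrite mul0r.
apply: prod_le_shift_ord => [|j|j|j].
- by rewrite mulr_ge0 ?ler0n.
- have /andP[_ rs] := rr (e, j).
  by rewrite (le_trans th0) ?cover_vertex_ge ?cover_vertex_le1 ?th0 ?ltW.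
- by rewrite pref_point_ge0 pref_point_le1.
apply: (le_trans (rle _ _)); rewrite Ek /= addrK liftK.
have /andP[r0 rs] := rr (e, j).
set rj := rho (e, j) in r0 rs *.
apply: (@le_trans _ _ ((n%:R * A%:R + rj%:R * (M%:R - A%:R)) / #|candidate|%:R)).
  rewrite ler_wpM2r ?invr_ge0 ?ler0n // -natrB // -!natrM -natrD ler_nat.
  rewrite -addnS leq_add2l -[X in (_ <= X * _)%N](prednK r0) mulSn addnC.
  by rewrite -addSn leq_add2r ltn_ord.
set x := A%:R / (s.+1 * M)%:R in tA thd thM *.
rewrite mulrDl tA /cover_vertex.
have -> : rj%:R * (M%:R - A%:R) / #|candidate|%:R =
          (s.+1%:R^-1 - x) * (rj%:R / n%:R).
  have -> : s.+1%:R^-1 = M%:R / (s.+1 * M)%:R :> R.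
    by rewrite natrM invfM mulrCA divff ?mulr1 ?gt_eqF.
  by rewrite -mulrBl mulf_div (mulrC rj%:R) natrM card_real (mulrAC s.+1%:R).
have q0 : 0 <= rj%:R / n%:R :> R by rewrite divr_ge0 ?ler0n.
have q1 : rj%:R / n%:R <= s%:R :> R by rewrite ler_pdivrMr // -natrM ler_nat.
set q := rj%:R / n%:R in q0 q1 *.
have h1 : (theta - x) * q <= d * s%:R by apply: ler_pM; rewrite ?subr_ge0 ?lerBlDl.
move: (_^-1) h1 => a; rewrite !mulrBl [d * _]mulrC; lra.
Qed.

End FromCover.

Lemma lower_grid (R : realType) (s : nat) (theta d : R) :
  0 <= theta < s.+1%:R^-1 -> 0 < d ->
  exists M A : nat, [/\ (0 < M)%N, (A <= M)%N,
    (A == 0)%N || (A%:R / (s.+1 * M)%:R < theta) &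
    theta <= A%:R / (s.+1 * M)%:R + d].
Proof.
move=> /andP[th0 th1] d0.
pose M := (Num.truncn (2 / d)).+1.
have Md : 2 / d < M%:R by exact: truncnS_gt.
have sM : 0 < (s.+1 * M)%:R :> R by rewrite ltr0n muln_gt0.
pose t := theta * (s.+1 * M)%:R.
have t0 : 0 <= t by rewrite mulr_ge0 // ltW.
have /andP[tl tu] := truncn_itv t0.
have tM : t <= M%:R.
  rewrite /t natrM mulrA ler_piMl ?ler0n //.
  by rewrite -ler_pdivlMr ?ltr0n // mul1r ltW.
have dM : 2 <= d * (s.+1 * M)%:R.
  rewrite ltW // -ltr_pdivrMl // mulrC (lt_le_trans Md) // ler_nat.
  by rewrite leq_pmull.
(* The predecessor makes the fraction strictly smaller than theta. It and the truncation lose at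
   most 2 grid units, which is why [M] exceeds 2 / d. *)
exists M, (Num.truncn t).-1; split=> //.
- rewrite (leq_trans (leq_pred _)) // -(ler_nat R); exact: le_trans tl tM.
- case E : (Num.truncn t) => [|k] //=; apply/orP; right.
  rewrite ltr_pdivrMr // -/t (lt_le_trans _ tl) // E ltr_nat //.
- rewrite -(ler_pM2r sM) mulrDl divfK ?gt_eqF // -/t.
  case E : (Num.truncn t) tu => [|k] /= tu; first by lra.
  by move: tu; rewrite -addn2 natrD; lra.
Qed.

Lemma f_inf_le_h_inf (R : realType) (s : nat) (theta : R) :
  (0 < s)%N -> 0 <= theta < s.+1%:R^-1 ->
  f_inf s.+1 theta <= h_inf s theta.
Proof.
move=> s0 th; apply: le_h_inf => // E rho b n0 lab Hb.
have b0 : 0 <= b.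
  have /card_gt0P[e _] := n0; apply: le_trans (Hb e).
  apply: prodr_ge0 => j _; have /andP[th0 th1] := th.
  by rewrite (le_trans th0) ?cover_vertex_ge ?ltW.
apply/ler_addgt0Pr => eps eps0.
have ss : 0 < s%:R * s%:R :> R by rewrite mulr_gt0 ?ltr0n.
have d0 : 0 < eps / (s%:R * s%:R) by rewrite divr_gt0.
have [M [A [M0 AM Ath thd]]] := lower_grid th d0.
have := f_inf_le_labelling lab erefl s0 n0 M0 AM th Ath (ltW d0) thd b0 Hb.
by rewrite mulrA mulrCA divff ?mulr1 ?gt_eqF.
Qed.

(** * From preference orders to covers, with an error of order 1/m *)

Section FromPreference.
Variables (R : realType) (s m : nat) (P : 'I_s.+1 -> rel 'I_m).
Hypotheses (s_gt0 : (0 < s)%N) (m_gt0 : (0 < m)%N) (Ptot : preference_order P).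

Definition kept (theta : R) : pred 'I_m :=
  [pred k | [forall i, theta <= pref_point R P k i]].

Lemma pref_pointE k i : pref_point R P k i = (rank_of (P i) k)%:R / m%:R.
Proof. by []. Qed.

(** Ranks are distinct and start at 1, so each order discards at most [c] candidates; a union bound
    follows. The parameter [c] is left free because theta = 1/(s+1) needs a sharper value than the
    truncation of theta m. *)
Lemma card_kept (theta : R) (c : nat) :
  (forall q : nat, q%:R / m%:R < theta -> (q <= c)%N) ->
  (m <= #|kept theta| + s.+1 * c)%N.
Proof.
move=> Hc; rewrite -[X in (X <= _)%N](card_ord m) -(cardC (kept theta)) leq_add2l.
pose low (i : 'I_s.+1) := [pred k | pref_point R P k i < theta].
have low_c i : (#|low i| <= c)%N.
  rewrite -[c](subn1 c.+1); apply: (@card_inj_range _ _ (rank_of (P i))).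
    by move=> j k _ _; exact: rank_of_inj.
  by move=> k /Hc kc; rewrite rank_of_gt0 //= ltnS.
apply: (@leq_trans (\sum_(i < s.+1) #|low i|)); last first.
  rewrite -[X in (_ <= X * _)%N](card_ord s.+1) -sum_nat_const.
  by apply: leq_sum => i _; exact: low_c.
rewrite -sum1_card; under [X in (_ <= X)%N]eq_bigr do rewrite -sum1_card.
(* After the exchange each candidate counts the orders in which it is low, and a discarded one is
   low at least once. *)
rewrite (exchange_big_dep predT) //= big_mkcond /=.
apply: leq_sum => k _; case: ifP => //; rewrite !inE => /forallPn[i Hi].
by rewrite (bigD1 i) // inE ltNge.
Qed.

Section Labelling.
Variable theta : R.
Hypotheses (theta_ge0 : 0 <= theta) (theta_lt : theta < s.+1%:R^-1).

Local Notation K := {k : 'I_m | kept theta k}.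

Lemma card_kept_ge : (1 - s.+1%:R * theta) * m%:R <= #|{: K}|%:R :> R.
Proof.
have t0 : 0 <= theta * m%:R by rewrite mulr_ge0 ?ler0n.
have /andP[tl tu] := truncn_itv t0.
have : (m <= #|{: K}| + s.+1 * Num.truncn (theta * m%:R))%N.
  rewrite card_sig; apply: card_kept => q; rewrite ltr_pdivrMr ?ltr0n // => qm.
  by rewrite -ltnS -(ltr_nat R) (lt_trans qm).
rewrite -(ler_nat R) natrD natrM => h.
have : s.+1%:R * (Num.truncn (theta * m%:R))%:R <= s.+1%:R * (theta * m%:R) :> R.
  by rewrite ler_wpM2l ?ler0n.
rewrite mulrBl mul1r -mulrA; move: h.
set a := _ * _%:R; set b := _ * (_ * _); lra.
Qed.

Lemma kept_nonempty : (0 < #|{: K}|)%N.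
Proof.
rewrite -(ltr_nat R); apply: lt_le_trans card_kept_ge.
by rewrite mulr_gt0 ?ltr0n // subr_gt0 -ltr_pdivlMl ?ltr0n // mulr1.
Qed.

Variable top : K -> 'I_s.+1.

(** A slot [(k, j)] stands for one of the s coordinates of the kept candidate [k] other than the
    omitted one, [top k]. *)
Definition slot_rank (p : K * 'I_s) : nat :=
  rank_of (P (lift (top p.1) p.2)) (val p.1).

(* Ties between equal ranks in different orders are broken arbitrarily. *)
Definition slot_key (p : K * 'I_s) : nat :=
  (slot_rank p * #|{: K * 'I_s}| + enum_rank p)%N.

Lemma slot_key_inj : injective slot_key.
Proof.
move=> p q /(divmod_inj (ltn_ord _) (ltn_ord _))[_ /val_inj].
exact: enum_rank_inj.
Qed.

Definition slot_label : K * 'I_s -> nat :=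
  rank_of (fun p q => (slot_key p <= slot_key q)%N).

Lemma slot_label_labelling : labelling slot_label.
Proof.
have tot := key_total_order slot_key_inj.
split=> [|p]; first exact: rank_of_inj.
rewrite rank_of_gt0 //= (leq_trans (rank_of_max _ _)) //.
by rewrite card_prod card_ord mulnC.
Qed.

(* Each rank is attained once in each of the [s + 1] orders. *)
Lemma slot_label_le (c : nat) (p : K * 'I_s) :
  (forall q, c <= slot_rank q)%N ->
  (slot_label p <= s.+1 * ((slot_rank p).+1 - c))%N.
Proof.
move=> cle; set W := ((slot_rank p).+1 - c)%N.
(* [g] encodes the order of a slot together with its rank above [c]; this pair determines the slot,
   and the rank part is below [W] when the key is at most that of [p]. *)
pose g (q : K * 'I_s) := (lift (top q.1) q.2 * W + (slot_rank q - c))%N.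
have gW (q : K * 'I_s) : (slot_key q <= slot_key p)%N -> (slot_rank q - c < W)%N.
  move=> qp; have cq := cle q.
  suff : (slot_rank q <= slot_rank p)%N by rewrite /W; lia.
  rewrite leqNgt; apply/negP => pq.
  have := block_lt (ltnSn (slot_rank p)) (ltn_ord (enum_rank p)).
  rewrite ltnNge => /negP; apply; apply: leq_trans qp.
  exact: leq_trans (leq_mul pq (leqnn _)) (leq_addr _ _).
rewrite -[leqRHS]subn0; apply: (@card_inj_range _ _ g).
  move=> [k1 j1] [k2 j2]; rewrite !inE => /gW w1 /gW w2.
  move=> /(divmod_inj w1 w2)[/val_inj /= ll rr].
  have := cle (k1, j1); have := cle (k2, j2).
  move: rr; rewrite /slot_rank /= ll => rr c1 c2.
  have /(rank_of_inj (Ptot _)) /val_inj kk :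
      rank_of (P (lift (top k2) j2)) (val k1) =
      rank_of (P (lift (top k2) j2)) (val k2).
    by rewrite -[LHS](subnK c2) -[RHS](subnK c1); congr (_ + _)%N.
  by move: ll; rewrite kk => /lift_inj ->.
by move=> q; rewrite inE => /gW w; exact: block_lt (ltn_ord _) w.
Qed.

(** Let z be the rank of the slot, N the number of kept candidates, y = z + 2 - theta m. The label
    is at most (s+1) y, where 2 combines the successor in [slot_label_le] and the truncation of
    theta m. Since N >= (1 - (s+1) theta) m, the vertex is at most theta + y / m = z / m + 2 / m. *)
Lemma slot_vertex_le (p : K * 'I_s) :
  cover_vertex s theta #|{: K}| (slot_label p) <=
  pref_point R P (val p.1) (lift (top p.1) p.2) + 2 / m%:R.
Proof.
have mR : 0 < m%:R :> R by rewrite ltr0n.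
have NR : 0 < #|{: K}|%:R :> R by rewrite ltr0n kept_nonempty.
have t0 : 0 <= theta * m%:R by rewrite mulr_ge0 ?ler0n.
have /andP[tl tu] := truncn_itv t0.
have tle (q : K * 'I_s) : theta * m%:R <= (slot_rank q)%:R.
  by rewrite -ler_pdivlMr //; exact: (forallP (valP q.1)).
have cle (q : K * 'I_s) : (Num.truncn (theta * m%:R) <= slot_rank q)%N.
  by rewrite -(ler_nat R) (le_trans tl).
have := slot_label_le p cle; rewrite -(ler_nat R) natrM natrB; last first.
  by rewrite ltnW // ltnS.
set z := slot_rank p; set l := slot_label p; rewrite -(natr1 z) => lz.
set y := z%:R + 2 - theta * m%:R.
have y0 : 0 <= y by rewrite /y; have := tle p; rewrite -/z; lra.
have sR : 0 < s.+1%:R :> R by rewrite ltr0n.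
have ly : l%:R <= s.+1%:R * y.
  apply: (le_trans lz); rewrite ler_wpM2l ?ler0n //.
  by move: tu; rewrite /y -natr1; lra.
have -> : pref_point R P (val p.1) (lift (top p.1) p.2) + 2 / m%:R =
          theta + y / m%:R.
  by rewrite pref_pointE -/(slot_rank p) -/z /y !mulrDl mulNr mulfK ?gt_eqF //; lra.
rewrite /cover_vertex lerD2l mulrA ler_pdivrMr // [leRHS]mulrAC ler_pdivlMr //.
apply: (@le_trans _ _ ((s.+1%:R^-1 - theta) * (s.+1%:R * y) * m%:R)).
  by rewrite ler_wpM2r ?ler0n // ler_wpM2l // subr_ge0 ltW.
rewrite (mulrA (_ - _)) mulrBl mulVf ?gt_eqF // (mulrC theta) mulrAC.
rewrite [leRHS]mulrC.
by rewrite ler_wpM2r ?card_kept_ge.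
Qed.

End Labelling.

Lemma h_inf_le_f_pref_add (theta : R) : 0 <= theta < s.+1%:R^-1 ->
  h_inf s theta <= f_pref P theta + s%:R * (2 / m%:R).
Proof.
move=> th; have /andP[th0 th1] := th.
have [top Htop] : exists top : {k | kept theta k} -> 'I_s.+1, forall k,
    \prod_(j < s) pref_point R P (val k) (lift (top k) j) <= f_pref P theta.
  apply: (@fin_all_exists _ (fun=> 'I_s.+1) (fun k (i : 'I_s.+1) =>
    \prod_(j < s) pref_point R P (val k) (lift i j) <= f_pref P theta)).
  by move=> k; apply: le_f_pref; exact: (forallP (valP k)).
have d0 : 0 <= 2 / m%:R :> R by rewrite divr_ge0 ?ler0n.
have lab := slot_label_labelling top; have [_ lr] := lab.
have N0 := kept_nonempty th0 th1.
apply: (h_inf_le s_gt0 N0 th lab).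
  by rewrite addr_ge0 ?f_pref_ge0 ?mulr_ge0 ?ler0n.
move=> k; have := Htop k; rewrite -(lerD2r (s%:R * (2 / m%:R))).
apply: le_trans.
apply: prod_le_shift_ord => // j.
- by rewrite pref_point_ge0 pref_point_le1.
- have /andP[_ ls] := lr (k, j).
  by rewrite (le_trans th0) ?cover_vertex_ge ?cover_vertex_le1 ?th0 ?ltW.
- exact: (slot_vertex_le th0 th1 top (k, j)).
Qed.

End FromPreference.

(** * Replacing each candidate by [L] consecutive copies *)

Section BlowUp.
Variables (R : realType) (s m L : nat) (P : 'I_s.+1 -> rel 'I_m).
Hypothesis Ptot : preference_order P.

Definition copy_key (i : 'I_s.+1) (t : 'I_m * 'I_L) : nat :=
  (rank_of (P i) t.1 * L + t.2)%N.

Lemma copy_key_inj i : injective (copy_key i).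
Proof.
move=> [k l] [k' l'] /(divmod_inj (ltn_ord _) (ltn_ord _)) /= [].
by move=> /(rank_of_inj (Ptot i)) -> /val_inj ->.
Qed.

Definition blow_up (i : 'I_s.+1) (j k : 'I_#|{: 'I_m * 'I_L}|) : bool :=
  (copy_key i (enum_val j) <= copy_key i (enum_val k))%N.

Lemma blow_up_total : preference_order blow_up.
Proof.
move=> i; apply: (@key_total_order _ (fun j => copy_key i (enum_val j))).
by move=> j k /copy_key_inj /enum_val_inj.
Qed.

Lemma blow_up_point_le k i :
  pref_point R blow_up k i <= pref_point R P (enum_val k).1 i.
Proof.
case E : (enum_val k) => [k' l] /=.
have L0 : (0 < L)%N by exact: leq_ltn_trans (ltn_ord l).
have m0 : (0 < m)%N by exact: leq_ltn_trans (ltn_ord k').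
have LR : L%:R != 0 :> R by rewrite pnatr_eq0 -lt0n.
have -> : pref_point R P k' i =
    (rank_of (P i) k' * L)%:R / #|{: 'I_m * 'I_L}|%:R.
  by rewrite card_prod !card_ord !natrM -mulf_div divff ?mulr1.
rewrite ler_wpM2r ?invr_ge0 ?ler0n // ler_nat.
(* Ranks start at 1, so all keys are at least [L]; subtracting [L] absorbs the copy number [l] < [L]
   and the successor. *)
apply: (@leq_trans ((copy_key i (k', l)).+1 - L)); last first.
  by rewrite /copy_key /=; have := ltn_ord l; lia.
apply: (@card_inj_range _ _ (fun j => copy_key i (enum_val j))).
  by move=> j j' _ _ /copy_key_inj /enum_val_inj.
move=> j; rewrite inE /blow_up E ltnS => ->; rewrite andbT.
by rewrite (leq_trans _ (leq_addr _ _)) // leq_pmull ?rank_of_gt0.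
Qed.

(** Coordinates of a copy do not exceed those of its original, so the original of a kept copy is
    kept and has the larger product. *)
Lemma blow_up_f_pref_le (theta : R) : f_pref blow_up theta <= f_pref P theta.
Proof.
apply: f_pref_le => [|k Hk]; first exact: f_pref_ge0.
have [j Hj] : exists j : 'I_s.+1,
    \prod_(i < s) pref_point R P (enum_val k).1 (lift j i) <= f_pref P theta.
  by apply: le_f_pref => i; exact: le_trans (Hk i) (blow_up_point_le k i).
exists j; apply: le_trans Hj; apply: ler_prod => i _.
by rewrite pref_point_ge0 blow_up_point_le.
Qed.

End BlowUp.

Lemma h_inf_le_f_inf (R : realType) (s : nat) (theta : R) :
  (0 < s)%N -> 0 <= theta < s.+1%:R^-1 ->
  h_inf s theta <= f_inf s.+1 theta.
Proof.
move=> s0 th; apply: le_f_inf => m P m0 Ptot; apply/ler_addgt0Pr => eps eps0.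
pose L := (Num.truncn (s%:R * 2 / eps)).+1.
have mL : (0 < #|{: 'I_m * 'I_L}|)%N by rewrite card_prod !card_ord muln_gt0 m0.
have := h_inf_le_f_pref_add s0 mL (blow_up_total L Ptot) th.
move=> /le_trans; apply; apply: lerD; first exact: blow_up_f_pref_le.
rewrite mulrA ler_pdivrMr ?ltr0n // [eps * _]mulrC -ler_pdivrMr //.
apply: (@le_trans _ _ L%:R); first exact/ltW/truncnS_gt.
by rewrite ler_nat card_prod !card_ord leq_pmull.
Qed.

(** * The endpoint theta = 1/(s+1) *)

Section Endpoint.
Variables (R : realType) (s : nat).
Hypothesis s_gt0 : (0 < s)%N.

Local Notation a := (s.+1%:R^-1 : R).

Lemma f_inf_endpoint_ge : a ^+ s <= f_inf s.+1 a.
Proof.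
apply: le_f_inf => m P m0 Ptot.
(* A rank q with q / m < 1/(s+1) satisfies q (s+1) <= m - 1, so at most m - 1 candidates are
   discarded and one is kept. *)
have : (m <= #|kept P a| + s.+1 * (m.-1 %/ s.+1))%N.
  apply: card_kept => // q; rewrite ltr_pdivrMr ?ltr0n // mulrC.
  rewrite ltr_pdivlMr ?ltr0n // -natrM ltr_nat leq_divRL // => h.
  by rewrite -ltnS prednK.
have := leq_divM m.-1 s.+1; rewrite mulnC => h1 h2.
have /card_gt0P[k /forallP Hk] : (0 < #|kept P a|)%N by move: h1 h2; lia.
have [j] := le_f_pref Hk; apply: le_trans.
rewrite -[X in _ ^+ X](card_ord s) -prodr_const; apply: ler_prod => i _.
by rewrite invr_ge0 ler0n Hk.
Qed.

Lemma h_inf_ge (t : R) : 0 <= t < a -> t ^+ s <= h_inf s t.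
Proof.
move=> th; have /andP[t0 ta] := th; apply: le_h_inf => // E rho b.
move=> /card_gt0P[e _] _ /(_ e); apply: le_trans.
rewrite -[X in _ ^+ X](card_ord s) -prodr_const; apply: ler_prod => i _.
by rewrite t0 cover_vertex_ge ?ltW.
Qed.

(** The cover with n = 1 has a single edge, all of whose vertices are at most the last one. *)
Lemma h_inf_le_expr (t : R) : 0 <= t < a ->
  h_inf s t <= (t + (a - t) * s%:R) ^+ s.
Proof.
move=> th; have /andP[t0 ta] := th; have [rho lab] := labelling_exists s 1.
have b0 : 0 <= t + (a - t) * s%:R.
  by rewrite addr_ge0 ?mulr_ge0 ?ler0n ?subr_ge0 ?(ltW ta).
apply: (h_inf_le s_gt0 _ th lab); rewrite ?card_ord ?exprn_ge0 //.
move=> e; rewrite -[X in _ ^+ X](card_ord s) -prodr_const.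
apply: ler_prod => i _; have [_ /(_ (e, i)) /andP[_ rs]] := lab.
rewrite (le_trans t0) ?cover_vertex_ge ?(ltW ta) //=.
by rewrite card_ord in rs; apply: cover_vertex_le; rewrite ?(ltW ta).
Qed.

Lemma near_endpoint : (\forall t \near a^'-, 0 <= t < a)%classic.
Proof.
have a0 : 0 < a by rewrite invr_gt0 ltr0n.
near=> t; apply/andP; split; last by near: t; exact: nbhs_left_lt.
by near: t; exact: nbhs_left_ge.
Unshelve. all: by end_near. Qed.

Lemma h_inf_cvg : (h_inf s t @[t --> a^'-] --> a ^+ s)%classic.
Proof.
have idc : (t @[t --> a^'-] --> a)%classic by exact: cvg_at_left_filter.
apply: (squeeze_cvgr (f := fun t : R => t ^+ s)
    (h := fun t : R => (t + (a - t) * s%:R) ^+ s)).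
- by near=> t; rewrite h_inf_ge ?h_inf_le_expr //; near: t; exact: near_endpoint.
- exact: cvg_comp idc (@exprn_continuous R s a).
- have : (t + (a - t) * s%:R @[t --> a^'-] --> a + (a - a) * s%:R)%classic.
    by apply: cvgD => //; apply: cvgMr_tmp; apply: cvgB => //; exact: cvg_cst.
  rewrite subrr mul0r addr0 => lin.
  exact: cvg_comp lin (@exprn_continuous R s a).
Unshelve. all: by end_near. Qed.

Lemma f_inf_endpoint : f_inf s.+1 a = lim (h_inf s t @[t --> a^'-])%classic.
Proof.
rewrite (cvg_lim _ h_inf_cvg) //; apply/eqP; rewrite eq_le f_inf_endpoint_ge andbT.
apply: (cvgr_to_ge h_inf_cvg); near=> t.
have th : 0 <= t < a by near: t; exact: near_endpoint.
apply: le_trans (f_inf_le_h_inf s_gt0 th).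
by apply: f_inf_anti; case/andP: th => _ /ltW.
Unshelve. all: by end_near. Qed.

End Endpoint.

Theorem theorem7p2 (R : realType) (r : nat) (theta : R)
  (hr : (2 <= r)%N) (htheta0 : 0 <= theta) (htheta1 : theta <= r%:R^-1) :
  f_inf r theta = h_ext r.-1 theta.
Proof.
case: r hr htheta1 => // s s0 th1; rewrite /h_ext /=.
case: eqP => [->|/eqP ne]; first exact: f_inf_endpoint.
have th : 0 <= theta < s.+1%:R^-1 by rewrite htheta0 lt_neqAle ne.
by apply/eqP; rewrite eq_le f_inf_le_h_inf ?h_inf_le_f_inf.
Qed.
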